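(* Let $K$ be a number field and $A$ its ring of integers. Then $A$ is coverable if and only if $A\neq\mathbb{Z}[\theta]$ for every unit $\theta$ of $A$.
   Context: Convention: a subring of a ring $R$ is an additive subgroup closed under multiplication, not necessarily containing $1$; proper means different from $R$. $R$ is coverable if it is the union of its proper subrings. $\mathbb{Z}[\theta]$ denotes the smallest subring of $A$ containing $1$ and $\theta$. *)

(* Defs.v *)
From HB Require Import structures.
From mathcomp Require Import all_boot all_order all_algebra all_field.
From mathcomp Require Import boolp classical_sets.

Set Implicit Arguments.
Unset Strict Implicit.
Unset Printing Implicit Defensive.

Import GRing.Theory.
Local Open Scope ring_scope.
Local Open Scope classical_set_scope.

(* Unlike [subring_closed], this does not require 1 to belong to the set. *)
Definition subring (R : pzRingType) (S : set R) : Prop :=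
  [/\ S 0,
      forall x y : R, S x -> S y -> S (x - y) &
      forall x y : R, S x -> S y -> S (x * y)].

Definition proper_subring (R : pzRingType) (S : set R) : Prop :=
  subring S /\ S <> setT.

Definition coverable (R : pzRingType) : Prop :=
  \bigcup_(S in [set S : set R | proper_subring S]) S = setT.

(* Z[theta], as the intersection of all subrings containing 1 and theta. *)
Definition adjoinZ (R : pzRingType) (theta : R) : set R :=
  smallest (@subring R) [set 1; theta].

(* A number field is a [fieldExtType rat], i.e. a finite-dimensional field
   extension of the rationals. *)
Section RingOfIntegers.
Variable K : fieldExtType rat.

Definition integral : {pred K} :=
  fun x => `[< integralOver (intr : int -> K) x >].

Lemma integralP (x : K) :
  reflect (integralOver (intr : int -> K) x) (x \in integral).
Proof. exact: asboolP. Qed.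

Fact integral_subring_closed : subring_closed integral.
Proof.
split=> [|x y /integralP hx /integralP hy|x y /integralP hx /integralP hy];
  apply/integralP.
- exact: integral1.
- exact: integral_sub.
- exact: integral_mul.
Qed.

HB.instance Definition _ :=
  GRing.isSubringClosed.Build K integral integral_subring_closed.

Record ringOfIntegers := RingOfIntegers {
  algint_val :> K;
  _ : algint_val \in integral
}.

HB.instance Definition _ := [isSub for algint_val].
HB.instance Definition _ := [Choice of ringOfIntegers by <:].
HB.instance Definition _ :=
  [SubChoice_isSubComNzRing of ringOfIntegers by <:].

Definition algint_unit : {pred ringOfIntegers} :=
  fun x => (val x != 0) && ((val x)^-1 \in integral).

Definition algint_inv (x : ringOfIntegers) : ringOfIntegers :=
  if x \in algint_unit then insubd x (val x)^-1 else x.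

Fact algint_mulVx : {in algint_unit, left_inverse 1 algint_inv *%R}.
Proof.
move=> x ux; have /andP[x0 ix] := ux.
apply: val_inj; rewrite rmorphM rmorph1 /algint_inv ux.
by rewrite /= val_insubd ix mulVf.
Qed.

Fact algint_unitPl (x y : ringOfIntegers) : y * x = 1 -> algint_unit x.
Proof.
move=> yx; have yx1 : val y * val x = 1 by rewrite -rmorphM yx rmorph1.
have x0 : val x != 0.
  apply/eqP=> x0; move: yx1; rewrite x0 mulr0 => /esym/eqP.
  by rewrite oner_eq0.
rewrite /algint_unit x0 /=.
suff -> : (val x)^-1 = val y by exact: valP.
by apply: (mulIf x0); rewrite mulVf.
Qed.

Fact algint_inv_out : {in [predC algint_unit], algint_inv =1 id}.
Proof. by move=> x; rewrite inE /algint_inv => /negbTE ->. Qed.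

HB.instance Definition _ :=
  GRing.ComNzRing_hasMulInverse.Build ringOfIntegers
    algint_mulVx algint_unitPl algint_inv_out.

End RingOfIntegers.

(* Main.v *)
Require Import Defs.
From mathcomp Require Import all_boot all_order all_algebra all_field.
From mathcomp Require Import boolp classical_sets.

(** An element theta lies in some proper subring unless the subring it generates,
    i.e. theta Z[theta], is the whole ring.  If theta Z[theta] is everything then
    it contains 1, so theta is a unit and Z[theta] is everything.  Conversely,
    if theta is a unit and Z[theta] is everything, then
    theta Z[theta] = theta A = A. *)

Set Implicit Arguments.
Unset Strict Implicit.
Unset Printing Implicit Defensive.

Import GRing.Theory.
Local Open Scope ring_scope.
Local Open Scope classical_set_scope.

Lemma smallest_subring (R : pzRingType) (G : set R) :
  subring (smallest (@subring R) G).
Proof.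
split=> [A [[A0 _ _] _] //|x y Sx Sy A hA|x y Sx Sy A hA];
  have [[_ AB AM] _] := hA.
- by apply: AB; [exact: Sx|exact: Sy].
- by apply: AM; [exact: Sx|exact: Sy].
Qed.

(** The stabilizer contains 1 even when [S] does not, so it can absorb all of [adjoinZ theta] as
    soon as it contains [theta]. *)
Lemma subring_left_stabilizer (R : pzRingType) (S : set R) :
  subring S -> subring [set x | forall s, S s -> S (x * s)].
Proof.
case=> S0 SB _; split=> [s _|x y Tx Ty s Ss|x y Tx Ty s Ss] /=.
- by rewrite mul0r.
- by rewrite mulrBl; apply: SB; [exact: Tx|exact: Ty].
- by rewrite -mulrA; apply/Tx/Ty.
Qed.

Lemma subring_principal_ideal (R : comPzRingType) (a : R) :
  subring (range ( *%R a)).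
Proof.
split=> [|_ _ [y _ <-] [z _ <-]|_ _ [y _ <-] [z _ <-]].
- by exists 0; rewrite ?mulr0.
- by exists (y - z); rewrite ?mulrBr.
- by exists (y * (a * z)); rewrite ?mulrA.
Qed.

(** Closure under multiplication by [theta] makes [S] a module over Z[theta], which here is all of
    [R]; it remains to bring 1 into [S]. *)
Lemma subring_full (R : unitRingType) (theta : R) (S : set R) :
  theta \is a GRing.unit -> adjoinZ theta = setT ->
  subring S -> S theta -> S = setT.
Proof.
move=> utheta full hS Stheta; have [_ _ SM] := hS.
have genT : [set 1; theta] `<=` [set x | forall s, S s -> S (x * s)].
  by move=> _ [->|->] s Ss /=; [rewrite mul1r|exact: SM].
have S1 : S 1.
  (* Write 1 as [theta^-1 * theta]: [theta^-1] lies in Z[theta], hence stabilizes [S], and [theta]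
     is in [S]. *)
  rewrite -(mulVr utheta).
  have : adjoinZ theta theta^-1 by rewrite full.
  by move/(smallest_sub (subring_left_stabilizer hS) genT); apply.
apply/seteqP; split=> // x _.
have : adjoinZ theta x by rewrite full.
by apply: (smallest_sub hS) => _ [->|->].
Qed.

(** The subring generated by [theta] alone stays inside the ideal [theta * R], so having 1 in it
    yields an inverse of [theta]. *)
Lemma subring_generator_unit (R : comUnitRingType) (theta : R) :
  smallest (@subring R) [set theta] = setT -> theta \is a GRing.unit.
Proof.
move=> full; have : smallest (@subring R) [set theta] 1 by rewrite full.
have gen : [set theta] `<=` range ( *%R theta).
  by move=> _ ->; exists 1; rewrite ?mulr1.
case/(smallest_sub (subring_principal_ideal theta) gen) => y _ ty.
by apply/unitrPr; exists y.
Qed.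

Lemma coverable_adjoinZ (R : comUnitRingType) :
  coverable R <->
  (forall theta : R, theta \is a GRing.unit -> [set: R] <> adjoinZ theta).
Proof.
split=> [cov theta utheta full|noZ].
  have : [set: R] theta by [].
  rewrite -cov => -[S [hS SnT] Stheta]; apply: SnT.
  exact: subring_full utheta (esym full) hS Stheta.
apply/seteqP; split=> // theta _.
exists (smallest (@subring R) [set theta]); last exact: sub_gen_smallest.
split=> [|full]; first exact: smallest_subring.
(* Z[theta] contains the subring generated by [theta] alone, so it is also the whole ring, against
   [noZ]. *)
apply: (noZ theta (subring_generator_unit full)).
apply/seteqP; split=> // x _; have : [set: R] x by [].
rewrite -full; apply: (smallest_sub (smallest_subring _)) => _ ->.
by apply: sub_gen_smallest; right.
Qed.

Theorem theorem1 (K : fieldExtType rat) :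
  coverable (ringOfIntegers K) <->
  (forall theta : ringOfIntegers K,
     theta \is a GRing.unit -> [set: ringOfIntegers K] <> adjoinZ theta).
Proof. exact: coverable_adjoinZ. Qed.
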